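(* Let $x_0$ be a real number such that for every $x>x_0$ the interval $[x-x^{0.525},x]$ contains a prime, and let $r$ be the index with $p_{r-1}\le x_0<p_r$. Then for every real $k\ge\frac{40}{19}$ and every integer $n>p_r$ there is a prime $q$ with $n-\left(k-\frac12\right)n^{\frac{k-1}{k}}<q<n$.
   Context: $p_1=2,p_2=3,\dots$ denotes the sequence of primes in increasing order. A constant $x_0$ as in the claim exists (Baker–Harman–Pintz: for all sufficiently large $x$ the interval $[x-x^{0.525},x]$ contains a prime). *)

(* Defs.v *)
From mathcomp Require Import all_boot.

Set Implicit Arguments.
Unset Strict Implicit.
Unset Printing Implicit Defensive.

Lemma ex_prime_gt (m : nat) : exists p, (m < p) && prime p.
Proof. by case: (prime_above m) => p mp pp; exists p; rewrite mp. Qed.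

Definition next_prime (m : nat) : nat := ex_minn (ex_prime_gt m).

(* Indexed from 1: nth_prime 1 = 2, nth_prime 2 = 3, ...; the value
   nth_prime 0 = 0 is a dummy. *)
Definition nth_prime (i : nat) : nat := iter i next_prime 0.

Lemma nth_primeS_prime (i : nat) : prime (nth_prime i.+1).
Proof. by rewrite /nth_prime /= /next_prime; case: ex_minnP => p /andP[]. Qed.

Lemma nth_prime_lt (i : nat) : nth_prime i < nth_prime i.+1.
Proof. by rewrite {2}/nth_prime /= /next_prime; case: ex_minnP => p /andP[]. Qed.

Lemma nth_prime_surj (q : nat) : prime q -> exists2 i, 0 < i & nth_prime i = q.
Proof.
move=> qp; have ltq : exists i, q <= nth_prime i.
  exists q; elim: {qp}q => // q IH; exact: leq_ltn_trans IH (nth_prime_lt q).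
case: (ex_minnP ltq) => -[|i] qi mini.
  by move: qi (prime_gt0 qp); rewrite leqn0 => /eqP->.
exists i.+1 => //; apply/eqP; rewrite eqn_leq qi andbT.
have iq : nth_prime i < q by rewrite ltnNge; apply/negP => /mini; rewrite ltnn.
rewrite {1}/nth_prime /= /next_prime; case: ex_minnP => p _; apply.
by rewrite iq.
Qed.

(* Main.v *)
Require Import Defs.
From mathcomp Require Import all_boot all_order all_algebra.
From mathcomp Require Import lra.
From mathcomp Require Import all_classical all_reals all_analysis.

Set Implicit Arguments.
Unset Strict Implicit.
Unset Printing Implicit Defensive.

Import Order.TTheory GRing.Theory Num.Theory.
Local Open Scope ring_scope.

(* Apply the hypothesis at [n - 1], so that the prime found is strictly below [n].
   With [t = n `^ ((k - 1) / k)], the exponent is at least [1 - 19/40 = 525/1000],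
   hence [1 + (n - 1) `^ (525 / 1000) <= 1 + t], and this is less than
   [(k - 1/2) t] because [k - 3/2 >= 23/38] and [t >= 4 `^ (1/2) = 2]. *)
Theorem theorem11 (R : realType) (x0 : R)
  (hx0 : forall x : R, x0 < x ->
    exists p : nat, prime p /\ x - x `^ (525 / 1000) <= p%:R <= x)
  (r : nat) (hr : (1 < r)%N)
  (hx0r : (nth_prime r.-1)%:R <= x0 < (nth_prime r)%:R)
  (k : R) (hk : 40 / 19 <= k)
  (n : int) (hn : (nth_prime r)%:Z < n) :
  exists q : nat, prime q /\
    n%:~R - (k - 1 / 2) * n%:~R `^ ((k - 1) / k) < (q%:R : R) < n%:~R.
Proof.
case: r hr hx0r hn => [|[|s]] //= _ /andP[_ x0p] hn.
have p3 : (2 < nth_prime s.+2)%N.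
  exact: leq_ltn_trans (prime_gt1 (nth_primeS_prime s)) (nth_prime_lt s.+1).
(* With [n = m + 1], the strict bound on [n] becomes [nth_prime s.+2 <= m], so [x0 < m]. *)
case: n hn => // -[//|m]; rewrite ltz_nat ltnS => pm.
rewrite -pmulrn -[m.+1%:R]natr1.
have m3 : 3 <= m%:R :> R by rewrite (ler_nat R 3) (leq_trans p3).
have [q [qp /andP[qlb qub]]] : exists q : nat, prime q /\
    (m%:R : R) - m%:R `^ (525 / 1000) <= q%:R <= (m%:R : R).
  by apply: hx0; rewrite (lt_le_trans x0p) // ler_nat.
exists q; split => //.
have kE : 525 / 1000 <= (k - 1) / k.
  by rewrite ler_pdivlMr; lra.
set t := (m%:R + 1) `^ ((k - 1) / k).
have m_le_t : m%:R `^ (525 / 1000) <= t.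
  apply: (@le_trans _ _ ((m%:R + 1) `^ (525 / 1000))).
    by apply: ge0_ler_powR; rewrite ?nnegrE; lra.
  by apply: ler_powR => //; lra.
have t2 : 2 <= t.
  apply: (@le_trans _ _ ((m%:R + 1) `^ (2^-1))); last first.
    by apply: ler_powR; lra.
  (* Once 2 is a power of [2 ^+ 2] with exponent [2^-1], monotonicity in the base needs only
     [4 <= m + 1]. *)
  rewrite -[2 in leLHS]ger0_norm // -sqrtr_sqr -powR12_sqrt; last exact: sqr_ge0.
  by apply: ge0_ler_powR; rewrite ?nnegrE; lra.
(* Here [61 / 38 = 40 / 19 - 1 / 2]. The constant factor makes the goal linear in [t]:
   [1 + t < 61 / 38 * t] as soon as [t > 38 / 23]. *)
have ge_kt : 61 / 38 * t <= (k - 1 / 2) * t by apply: ler_wpM2r; lra.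
by apply/andP; split; lra.
Qed.
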